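(* A directed graph is determined up to isomorphism by its magnitude cohomology ring: if $G$ and $G'$ are directed graphs and $\mathrm{MH}^*_*(G)\cong\mathrm{MH}^*_*(G')$ as bigraded rings, then $G$ and $G'$ are isomorphic as directed graphs.
   Context: A directed graph $G$ here is a set of vertices $V$ with an irreflexive binary relation (the directed edges $x\to y$, $x\ne y$); so there are no loops and at most one edge from $x$ to $y$. It determines an extended quasi-metric space on $V$ via the shortest path metric: $d(x,y)$ is the least number of edges in a directed path from $x$ to $y$, or $\infty$ if there is none. The magnitude cohomology ring $\mathrm{MH}^*_*(G)$ is that of this extended quasi-metric space, defined as follows. An extended quasi-metric space is a set $X$ with a function $d\colon X\times X\to[0,\infty]$ such that $d(a,b)=0$ if and only if $a=b$, and $d(a,c)\leq d(a,b)+d(b,c)$ for all $a,b,c$ (symmetry and finiteness of $d$ are not required). A $k$-simplex ($k\ge 0$) in $X$ is a tuple $(x_0,\ldots,x_k)\in X^{k+1}$ with $x_{i-1}\neq x_i$ for all $i$; its length is $\ell(x_0,\ldots,x_k)=d(x_0,x_1)+\cdots+d(x_{k-1},x_k)$. For $\ell\in[0,\infty)$, $\mathrm{MC}_{k,\ell}(X)$ is the free abelian group on the $k$-simplices of length $\ell$, with differential $\partial=\sum_{i=1}^{k-1}(-1)^i\partial_i\colon \mathrm{MC}_{k,\ell}(X)\to\mathrm{MC}_{k-1,\ell}(X)$, where $\partial_i(x_0,\ldots,x_k)=(x_0,\ldots,\widehat{x_i},\ldots,x_k)$ if $d(x_{i-1},x_{i+1})=d(x_{i-1},x_i)+d(x_i,x_{i+1})$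 and $0$ otherwise. The magnitude cochain complex is $\mathrm{MC}^k_\ell(X)=\mathrm{Hom}(\mathrm{MC}_{k,\ell}(X),\mathbb{Z})$ with differential $\partial^*\varphi=\varphi\circ\partial$, and $\mathrm{MH}^k_\ell(X)=H^k(\mathrm{MC}^*_\ell(X))$. For $\varphi\in\mathrm{MC}^{k_1}_{\ell_1}(X)$ and $\psi\in\mathrm{MC}^{k_2}_{\ell_2}(X)$, the product $\varphi\cdot\psi\in\mathrm{MC}^{k_1+k_2}_{\ell_1+\ell_2}(X)$ sends a simplex $(x_0,\ldots,x_{k_1+k_2})$ of length $\ell_1+\ell_2$ to $\varphi(x_0,\ldots,x_{k_1})\,\psi(x_{k_1},\ldots,x_{k_1+k_2})$ if $\ell(x_0,\ldots,x_{k_1})=\ell_1$ and $\ell(x_{k_1},\ldots,x_{k_1+k_2})=\ell_2$, and to $0$ otherwise. The unit is the cochain $u\in\mathrm{MC}^0_0(X)$ with $u(x_0)=1$ for every $0$-simplex. This satisfies the Leibniz rule and makes $\mathrm{MH}^*_*(X)$ into an associative unital bigraded ring, the magnitude cohomology ring of $X$. An isomorphism of bigraded rings preserves both gradings. *)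

(* Defs.v *)
From HB Require Import structures.
From mathcomp Require Import all_boot all_order all_algebra.
From mathcomp Require Import generic_quotient ring_quotient freeg.
From mathcomp Require Import boolp classical_sets reals constructive_ereal.
From mathcomp Require Import interval_inference ereal zify.
Set Implicit Arguments.
Unset Strict Implicit.
Unset Printing Implicit Defensive.
Import Order.TTheory GRing.Theory Num.Theory.
Local Open Scope ring_scope.
Local Open Scope quotient_scope.

Section HomGroup.
Variables U V : zmodType.

HB.instance Definition _ := gen_eqMixin {additive U -> V}.
HB.instance Definition _ := gen_choiceMixin {additive U -> V}.

Implicit Types f g h : {additive U -> V}.

Lemma hom_ext f g : f =1 g -> f = g.
Proof.
case: f g => [f [[mf]]] [g [[mg]]] /= /funext fg; move: mf mg.
rewrite {}fg => mf mg; congr (GRing.Additive.Pack (GRing.Additive.Class _)).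
by congr GRing.isNmodMorphism.Axioms_; exact: Prop_irrelevance.
Qed.

Definition hom_zero : {additive U -> V} := (\0 : U -> V).
Definition hom_add f g : {additive U -> V} := f \+ g.
Definition hom_opp f : {additive U -> V} := \- f.

Lemma hom_addA : associative hom_add.
Proof. by move=> f g h; apply: hom_ext => x; exact: addrA. Qed.
Lemma hom_addC : commutative hom_add.
Proof. by move=> f g; apply: hom_ext => x; exact: addrC. Qed.
Lemma hom_add0 : left_id hom_zero hom_add.
Proof. by move=> f; apply: hom_ext => x; exact: add0r. Qed.
Lemma hom_addN : left_inverse hom_zero hom_opp hom_add.
Proof. by move=> f; apply: hom_ext => x; exact: addNr. Qed.

HB.instance Definition _ := GRing.isZmodule.Build {additive U -> V}
  hom_addA hom_addC hom_add0 hom_addN.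

Lemma hom_addE f g x : (f + g) x = f x + g x. Proof. by []. Qed.
Lemma hom_oppE f x : (- f) x = - f x. Proof. by []. Qed.
Lemma hom_zeroE x : (0 : {additive U -> V}) x = 0. Proof. by []. Qed.

End HomGroup.

(* The universal property of free abelian groups; zmodule M is M with its
   canonical int-module structure, as required by fglift. *)
Section FreeExtension.
Variables (S : choiceType) (M : zmodType) (f : S -> M).

Definition fgext (D : {freeg S / int}) : M :=
  @fglift int (zmodule M) S f D.

Lemma fgext_is_zmod_morphism : zmod_morphism fgext.
Proof. exact: (@lift_is_additive int S (zmodule M) f). Qed.

HB.instance Definition _ :=
  GRing.isZmodMorphism.Build {freeg S / int} M fgext fgext_is_zmod_morphism.

Lemma fgextU s : fgext << s >> = f s.
Proof. by rewrite /fgext liftU scale1r. Qed.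

End FreeExtension.

Lemma freeg_hom_ext (S : choiceType) (M : zmodType)
    (f g : {additive {freeg S / int} -> M}) :
  (forall s, f << s >> = g << s >>) -> f = g.
Proof.
move=> fg; apply: hom_ext => D; rewrite -(freeg_sumE D) !raddf_sum.
apply: eq_bigr => s _.
have -> : << (coeff s D) *g s >> = << s >> *~ coeff s D :> {freeg S / int}.
  by rewrite freegU_mulz intz.
by rewrite !raddfMz fg.
Qed.

(* Extended quasi-metric spaces: neither symmetry nor finiteness. *)
Record eqmetric (R : realType) := EQMetric {
  point :> Type;
  dist : point -> point -> \bar R;
  dist_ge0 : forall a b, (0 <= dist a b)%E;
  dist_eq0 : forall a b, dist a b = 0%E <-> a = b;
  dist_triangle : forall a b c, (dist a c <= dist a b + dist b c)%E
}.



Lemma ereal_cancel (R : realType) (a b u v : \bar R) (r : R) :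
  (0 <= a -> 0 <= b -> 0 <= u -> 0 <= v ->
   a + u + b = r%:E -> a + v + b = r%:E -> u = v)%E.
Proof.
case: a => [a||] //; case: b => [b||] //; case: u => [u||] //;
  case: v => [v||] //= _ _ _ _ au av.
by case: au av => <- [] /addIr /addrI ->.
Qed.

Section Magnitude.
Variables (R : realType) (X : eqmetric R).
Local Notation d := (@dist R X).

(* A tuple (x_0, ..., x_k) is read off the first k + 1 terms of a sequence
   x : nat -> X; later terms are irrelevant. *)
Definition nondeg k (x : nat -> X) := forall i, (i < k)%N -> x i <> x i.+1.

Definition len k (x : nat -> X) : \bar R := (\sum_(i < k) d (x i) (x i.+1))%E.

Definition is_simplex k (l : {nonneg R}) (x : nat -> X) :=
  nondeg k x /\ len k x = (l%:num)%:E.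

Definition seq_of k (x : 'I_k.+1 -> X) : nat -> X := fun n => x (inord n).

Record simplex k (l : {nonneg R}) := Simplex {
  vtx : 'I_k.+1 -> X;
  vtx_simplex : is_simplex k l (seq_of vtx)
}.
Local Notation sq s := (seq_of (vtx s)).

HB.instance Definition _ k l := gen_eqMixin (simplex k l).
HB.instance Definition _ k l := gen_choiceMixin (simplex k l).

Lemma seq_of_trunc k (x : nat -> X) n :
  (n <= k)%N -> seq_of (fun i : 'I_k.+1 => x i) n = x n.
Proof. by move=> nk; rewrite /seq_of inordK. Qed.

Lemma eq_is_simplex k l (x y : nat -> X) :
  (forall n, (n <= k)%N -> x n = y n) -> is_simplex k l x -> is_simplex k l y.
Proof.
move=> xy [nx lx]; split=> [i ik|].
  by rewrite -!xy ?(ltnW ik) //; exact: nx.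
by rewrite -lx; apply: eq_bigr => i _; rewrite -!xy // ltnW.
Qed.

Lemma trunc_simplex k l (x : nat -> X) : is_simplex k l x ->
  is_simplex k l (seq_of (fun i : 'I_k.+1 => x i)).
Proof. by apply: eq_is_simplex => n nk; rewrite seq_of_trunc. Qed.

Definition mk_simplex k l (x : nat -> X) (h : is_simplex k l x) :
  simplex k l := Simplex (trunc_simplex h).

Lemma simplex_ext k l (s t : simplex k l) : vtx s = vtx t -> s = t.
Proof.
case: s t => [x hx] [y hy] /= xy; case: _ / xy in hy *.
by congr Simplex; exact: Prop_irrelevance.
Qed.

Lemma eq_mk_simplex k l (x y : nat -> X)
    (hx : is_simplex k l x) (hy : is_simplex k l y) :
  (forall n, (n <= k)%N -> x n = y n) -> mk_simplex hx = mk_simplex hy.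
Proof.
move=> xy; apply: simplex_ext; apply/funext => i /=; apply: xy.
by rewrite -ltnS.
Qed.

Lemma mk_simplex_vtx k l (s : simplex k l) (h : is_simplex k l (sq s)) :
  mk_simplex h = s.
Proof.
by apply: simplex_ext; apply/funext => i /=; rewrite /seq_of inord_val.
Qed.

Lemma len_cat k1 k2 (x : nat -> X) :
  len (k1 + k2) x = (len k1 x + len k2 (fun n => x (k1 + n)%N))%E.
Proof.
rewrite /len big_split_ord /=; congr (_ + _)%E.
by apply: eq_bigr => i _; rewrite addnS.
Qed.

Lemma len_ge0 k (x : nat -> X) : (0 <= len k x)%E.
Proof. by apply: sume_ge0 => i _; exact: dist_ge0. Qed.

Lemma len_around k (x : nat -> X) i : (i < k)%N ->
  len k.+1 x = (len i x + (d (x i) (x i.+1) + d (x i.+1) (x i.+2))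
                + len (k - i.+1) (fun n => x (i.+2 + n)%N))%E.
Proof.
move=> ik; rewrite (_ : k.+1 = i + (2 + (k - i.+1)))%N; last by lia.
rewrite !len_cat addeA; congr (_ + _ + _)%E.
  by rewrite /len big_ord_recr big_ord_recr big_ord0 /= add0e addn0 !addnS addn0.
by congr len; apply/funext => n; congr x; lia.
Qed.

Lemma len_skip k (x : nat -> X) i : (i < k)%N ->
  len k (fun n => x (bump i.+1 n)) =
    (len i x + d (x i) (x i.+2) + len (k - i.+1) (fun n => x (i.+2 + n)%N))%E.
Proof.
move=> ik; rewrite [in LHS](_ : k = i + (1 + (k - i.+1)))%N; last by lia.
rewrite !len_cat addeA; congr (_ + _ + _)%E.
- apply: eq_bigr => j _; have ji := ltn_ord j.
  by congr d; congr x; rewrite /bump; lia.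
- by rewrite /len big_ord1 /bump /=; congr d; congr x; lia.
- by congr len; apply/funext => n; congr x; rewrite /bump; lia.
Qed.

(* the vertex x_(i+1) lies between its neighbours *)
Definition between (x : nat -> X) i :=
  (d (x i) (x i.+2) = d (x i) (x i.+1) + d (x i.+1) (x i.+2))%E.

Lemma face_simplex k l (x : nat -> X) i : is_simplex k.+1 l x -> (i < k)%N ->
  between x i -> is_simplex k l (fun n => x (bump i.+1 n)).
Proof.
move=> [nx lx] ik bi; split; last first.
  by rewrite (len_skip _ ik) bi -(len_around _ ik).
move=> j jk; have [ji|ij|->] := ltngtP j i.
- rewrite (_ : bump i.+1 j = j) 1?(_ : bump i.+1 j.+1 = j.+1);
    by [apply: nx; lia | rewrite /bump; lia].
- rewrite (_ : bump i.+1 j = j.+1) 1?(_ : bump i.+1 j.+1 = j.+2);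
    by [apply: nx; lia | rewrite /bump; lia].
rewrite (_ : bump i.+1 i = i) 1?(_ : bump i.+1 i.+1 = i.+2);
  [|by rewrite /bump; lia..].
move=> /dist_eq0; rewrite bi => /eqP.
rewrite padde_eq0 ?dist_ge0 // => /andP[/eqP/dist_eq0 e _].
by apply: (nx i) => //; lia.
Qed.

Lemma face_between k l (x : nat -> X) i : is_simplex k.+1 l x -> (i < k)%N ->
  is_simplex k l (fun n => x (bump i.+1 n)) -> between x i.
Proof.
move=> [_ lx] ik [_]; rewrite (len_skip _ ik) => lf.
move: lx; rewrite (len_around _ ik) => lx; rewrite /between.
by apply: ereal_cancel lf lx; rewrite ?adde_ge0 ?dist_ge0 ?len_ge0.
Qed.

Definition MC k l := {freeg (simplex k l) / int}.

(* The face of s omitting the vertex of index i + 1. *)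
Definition face k l (s : simplex k.+1 l) (i : 'I_k) : MC k l :=
  match pselect (between (sq s) i) with
  | left h => << mk_simplex (face_simplex (vtx_simplex s) (ltn_ord i) h) >>
  | right _ => 0
  end.

Definition boundary k l : MC k.+1 l -> MC k l :=
  fgext (fun s => \sum_(i < k) face s i *~ (-1) ^+ i.+1).
HB.instance Definition _ k l := GRing.Additive.on (@boundary k l).

Definition cochain k l := {additive MC k l -> int}.
HB.instance Definition _ k l := GRing.Zmodule.on (cochain k l).

Definition cobound k l (f : cochain k l) : cochain k.+1 l :=
  f \o @boundary k l.

Lemma cobound_is_zmod_morphism k l : zmod_morphism (@cobound k l).
Proof. by move=> f g; apply: hom_ext. Qed.
HB.instance Definition _ k l := GRing.isZmodMorphism.Build
  (cochain k l) (cochain k.+1 l) (@cobound k l) (@cobound_is_zmod_morphism k l).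

Lemma front_simplex k1 k2 l1 (x : nat -> X) : nondeg (k1 + k2) x ->
  len k1 x = (l1%:num)%:E -> is_simplex k1 l1 x.
Proof. by move=> nx lx; split=> // i ik; apply: nx; lia. Qed.

Lemma back_simplex k1 k2 l2 (x : nat -> X) : nondeg (k1 + k2) x ->
  len k2 (fun n => x (k1 + n)%N) = (l2%:num)%:E ->
  is_simplex k2 l2 (fun n => x (k1 + n)%N).
Proof. by move=> nx lx; split=> // i ik; rewrite addnS; apply: nx; lia. Qed.

Local Notation "l1 +l l2" := ((l1%:num + l2%:num)%:nng) (at level 50).

Definition cochain_mul k1 l1 k2 l2 (f : cochain k1 l1) (g : cochain k2 l2) :
    cochain (k1 + k2) (l1 +l l2) :=
  fgext (fun s : simplex (k1 + k2) (l1 +l l2) =>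
    match pselect (len k1 (sq s) = (l1%:num)%:E),
          pselect (len k2 (fun n => sq s (k1 + n)%N) = (l2%:num)%:E) with
    | left h1, left h2 =>
        f << mk_simplex (front_simplex (vtx_simplex s).1 h1) >> *
        g << mk_simplex (back_simplex (vtx_simplex s).1 h2) >>
    | _, _ => 0
    end).

Definition cochain_one : cochain 0 0%:nng :=
  fgext (fun _ : simplex 0 0%:nng => 1 : int).

(* The value of f on the tuple (x_0, ..., x_k), extended by zero to tuples
   that are not k-simplices of length l; used in proofs only. *)
Definition ev k l (f : cochain k l) (x : nat -> X) : int :=
  match pselect (is_simplex k l x) with
  | left h => f << mk_simplex h >>
  | right _ => 0
  end.

Lemma evE k l (f : cochain k l) (x : nat -> X) (h : is_simplex k l x) :
  ev f x = f << mk_simplex h >>.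
Proof.
by rewrite /ev; case: pselect => // h'; congr (f << _ >>); exact: eq_mk_simplex.
Qed.

Lemma ev_out k l (f : cochain k l) (x : nat -> X) :
  ~ is_simplex k l x -> ev f x = 0.
Proof. by rewrite /ev; case: pselect. Qed.

Lemma ev_vtx k l (f : cochain k l) (s : simplex k l) : ev f (sq s) = f << s >>.
Proof. by rewrite (evE f (vtx_simplex s)) mk_simplex_vtx. Qed.

Lemma eq_ev k l (f : cochain k l) (x y : nat -> X) :
  (forall n, (n <= k)%N -> x n = y n) -> ev f x = ev f y.
Proof.
move=> xy; have [hx|hx] := pselect (is_simplex k l x).
  have hy := eq_is_simplex xy hx; rewrite (evE f hx) (evE f hy).
  by congr (f << _ >>); exact: eq_mk_simplex.
rewrite !ev_out // => hy; apply: hx; apply: eq_is_simplex hy => n nk.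
by rewrite xy.
Qed.

Lemma ev_ext k l (f g : cochain k l) :
  (forall x, is_simplex k l x -> ev f x = ev g x) -> f = g.
Proof.
move=> fg; apply: freeg_hom_ext => s; rewrite -!ev_vtx.
by apply: fg; exact: vtx_simplex.
Qed.

Lemma evB k l (f g : cochain k l) x : ev (f - g) x = ev f x - ev g x.
Proof. by rewrite /ev; case: pselect => // _; rewrite subr0. Qed.

Lemma evD k l (f g : cochain k l) x : ev (f + g) x = ev f x + ev g x.
Proof. by rewrite /ev; case: pselect => // _; rewrite addr0. Qed.

Lemma ev0 k l x : ev (0 : cochain k l) x = 0.
Proof. by rewrite /ev; case: pselect. Qed.

Lemma ev_cobound k l (f : cochain k l) x : is_simplex k.+1 l x ->
  ev (cobound f) x =
    \sum_(i < k) (-1) ^+ i.+1 * ev f (fun n => x (bump i.+1 n)).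
Proof.
move=> hx; rewrite (evE _ hx) /= /boundary fgextU raddf_sum.
apply: eq_bigr => i _; rewrite raddfMz -mulrzl intz; congr (_ * _).
set y := sq (mk_simplex hx).
have xy n : (n <= k.+1)%N -> y n = x n by exact: seq_of_trunc.
have xyb n : (n <= k)%N -> y (bump i.+1 n) = x (bump i.+1 n).
  by move=> nk; apply: xy; rewrite /bump; lia.
rewrite -(eq_ev f xyb) /face; case: pselect => [h|h].
  by rewrite -evE.
rewrite raddf0 ev_out // => /face_between h'; apply: h; apply: h' => //.
exact: trunc_simplex.
Qed.

Lemma ev_mul k1 l1 k2 l2 (f : cochain k1 l1) (g : cochain k2 l2) x :
  ev (cochain_mul f g) x = ev f x * ev g (fun n => x (k1 + n)%N).
Proof.
have [hx|hx] := pselect (is_simplex (k1 + k2) (l1 +l l2) x); last first.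
  rewrite ev_out //; have [[n1 e1]|/(ev_out f)->] := pselect (is_simplex k1 l1 x);
    last by rewrite mul0r.
  have [[n2 e2]|/(ev_out g)->] :=
    pselect (is_simplex k2 l2 (fun n => x (k1 + n)%N)); last by rewrite mulr0.
  case: hx; split; last by rewrite len_cat e1 e2.
  move=> i ik; have [|ki] := ltnP i k1; first exact: n1.
  have := n2 (i - k1)%N; rewrite addnS subnKC //; apply; lia.
rewrite (evE _ hx) /cochain_mul /= fgextU.
set y := sq (mk_simplex hx).
have xy n : (n <= k1 + k2)%N -> y n = x n by exact: seq_of_trunc.
rewrite -(@eq_ev _ _ f y x) => [|n nk]; last by apply: xy; lia.
rewrite -(@eq_ev _ _ g (fun n => y (k1 + n)%N) (fun n => x (k1 + n)%N));
  last by move=> n nk; apply: xy; lia.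
case: pselect => [h1|h1]; last by rewrite [ev f _]ev_out ?mul0r // => -[].
case: pselect => [h2|h2]; last by rewrite [ev g _]ev_out ?mulr0 // => -[].
by rewrite -!evE.
Qed.

Lemma is_simplex_front k1 k2 l1 l2 x : is_simplex (k1 + k2) (l1 +l l2) x ->
  is_simplex k2 l2 (fun n => x (k1 + n)%N) -> is_simplex k1 l1 x.
Proof.
move=> [nx]; rewrite len_cat => lx [_ l2x]; apply: front_simplex nx _.
move: lx; rewrite l2x; case: (len k1 x) => //= r [e].
by congr EFin; exact: (addIr l2%:num).
Qed.

Lemma is_simplex_back k1 k2 l1 l2 x : is_simplex (k1 + k2) (l1 +l l2) x ->
  is_simplex k1 l1 x -> is_simplex k2 l2 (fun n => x (k1 + n)%N).
Proof.
move=> [nx]; rewrite len_cat => lx [_ l1x]; apply: back_simplex nx _.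
move: lx; rewrite l1x; case: (len k2 _) => //= r [e].
by congr EFin; exact: (addrI l1%:num).
Qed.

Lemma leibniz k1 l1 k2 l2 (f : cochain k1 l1) (g : cochain k2 l2) x :
  is_simplex (k1 + k2).+1 (l1 +l l2) x ->
  ev (cobound (cochain_mul f g)) x =
    ev (cobound f) x * ev g (fun n => x (k1.+1 + n)%N) +
    (-1) ^+ k1 * (ev f x * ev (cobound g) (fun n => x (k1 + n)%N)).
Proof.
move=> hx; rewrite (ev_cobound _ hx) big_split_ord /=; congr (_ + _).
  under eq_bigr => i _ do rewrite ev_mul.
  transitivity (\sum_(i < k1) (-1) ^+ i.+1 * ev f (fun n => x (bump i.+1 n)) *
                ev g (fun n => x (k1.+1 + n)%N)).
    apply: eq_bigr => i _; rewrite mulrA; congr (_ * _); apply: eq_ev => n _.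
    by congr x; rewrite /bump; have := ltn_ord i; lia.
  have [h2|h2] := pselect (is_simplex k2 l2 (fun n => x (k1.+1 + n)%N)).
    by rewrite ev_cobound ?mulr_suml //; apply: is_simplex_front h2; rewrite addSn.
  by rewrite (ev_out g h2) mulr0 big1 // => i _; rewrite mulr0.
under eq_bigr => i _ do rewrite ev_mul.
transitivity (\sum_(i < k2) (-1) ^+ k1 * (ev f x * ((-1) ^+ i.+1 *
    ev g (fun n => x (k1 + bump i.+1 n)%N)))).
  apply: eq_bigr => i _; rewrite -addnS exprD -mulrA [ev f x * _]mulrCA.
  congr (_ * (_ * (_ * _))); apply: eq_ev => n nk; congr x; rewrite /bump; lia.
have [h1|h1] := pselect (is_simplex k1 l1 x).
  rewrite ev_cobound ?mulr_sumr; last first.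
    by apply: is_simplex_back h1; rewrite addnS.
  exact: eq_bigr.
by rewrite (ev_out f h1) mul0r mulr0 big1 // => i _; rewrite mul0r mulr0.
Qed.

Lemma len_skip_le k (x : nat -> X) i : (i < k)%N ->
  (len k (fun n => x (bump i.+1 n)) <= len k.+1 x)%E.
Proof.
move=> ik; rewrite (len_skip _ ik) (len_around _ ik).
by rewrite leeD // leeD // dist_triangle.
Qed.

Lemma skip_simplex k l x i j : (i < k.+1)%N -> (j < k)%N ->
  is_simplex k.+2 l x ->
  is_simplex k l (fun n => x (bump i.+1 (bump j.+1 n))) ->
  is_simplex k.+1 l (fun n => x (bump i.+1 n)).
Proof.
move=> ik jk hx [_ lij]; have [_ lx] := hx; apply: (face_simplex hx ik).
have lf : len k.+1 (fun n => x (bump i.+1 n)) = (l%:num)%:E.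
  apply/le_anti/andP; split; first by rewrite -lx len_skip_le.
  by rewrite -lij; exact: (len_skip_le (fun n => x (bump i.+1 n)) jk).
move: lf lx; rewrite (len_skip _ ik) (len_around _ ik).
by apply: ereal_cancel; rewrite ?adde_ge0 ?dist_ge0 ?len_ge0.
Qed.

Lemma cobound_cobound k l (f : cochain k l) : cobound (cobound f) = 0.
Proof.
apply: ev_ext => x hx; rewrite ev0 (ev_cobound _ hx).
pose F i j := (-1) ^+ (i + j) * ev f (fun n => x (bump i.+1 (bump j.+1 n))).
transitivity (\sum_(i < k.+1) \sum_(j < k) F i j).
  apply: eq_bigr => i _.
  have [hi|hi] := pselect (is_simplex k.+1 l (fun n => x (bump i.+1 n))).
    rewrite (ev_cobound _ hi) mulr_sumr; apply: eq_bigr => j _.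
    by rewrite mulrA -exprD /F addSn addnS !exprS !mulN1r opprK.
  rewrite ev_out // mulr0 big1 // => j _; rewrite /F ev_out ?mulr0 // => hij.
  by apply: hi; apply: skip_simplex hij.
under eq_bigr => i _ do rewrite (bigID (fun j : 'I_k => (i <= j)%N)) /=.
rewrite big_split /= big_ord_recr /= [X in _ + X + _]big_pred0 ?addr0; last first.
  by move=> j; rewrite leqNgt ltn_ord.
rewrite big_ord_recl /= [X in _ + (X + _)]big_pred0 ?add0r //.
rewrite (exchange_big_dep predT) //= -big_split /= big1 // => i _.
apply/eqP; rewrite addr_eq0 -sumrN; apply/eqP.
apply: eq_big => [j|j ji]; first by rewrite /bump add1n -leqNgt.
rewrite /F /bump /= add1n addSn exprS mulN1r mulNr opprK addnC; congr (_ * _).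
by apply: eq_ev => n _; congr x; rewrite /bump; lia.
Qed.

Definition cocycle k l : {pred cochain k l} := fun f => cobound f == 0.

Lemma cocycle_zmod_closed k l : zmod_closed (@cocycle k l).
Proof.
split=> [|f g /eqP f0 /eqP g0]; apply/eqP; first exact: raddf0.
by rewrite raddfB /= f0 g0 subr0.
Qed.
HB.instance Definition _ k l :=
  GRing.isZmodClosed.Build (cochain k l) (@cocycle k l)
    (@cocycle_zmod_closed k l).

Record cocycles k l := Cocycle {
  cocycle_val :> cochain k l;
  cocycle_valP : cocycle_val \in @cocycle k l
}.
HB.instance Definition _ k l := [isSub for @cocycle_val k l].
HB.instance Definition _ k l := [Choice of cocycles k l by <:].
HB.instance Definition _ k l :=
  [SubChoice_isSubZmodule of cocycles k l by <:].

Lemma cobound_cocycle k l (z : cocycles k l) : cobound z = 0.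
Proof. exact/eqP/(valP z). Qed.

Definition is_coboundary k l : cochain k l -> Prop :=
  match k with
  | 0 => fun f => f = 0
  | k'.+1 => fun f => exists g : cochain k' l, f = cobound g
  end.

Lemma is_coboundary0 k l : is_coboundary (0 : cochain k l).
Proof. by case: k => [|k] //=; exists 0; rewrite raddf0. Qed.

Lemma is_coboundary_cocycle k l (f : cochain k l) :
  is_coboundary f -> f \in @cocycle k l.
Proof.
case: k f => [|k] f /= => [->|[g ->]]; first exact: rpred0.
by apply/eqP; exact: cobound_cobound.
Qed.

Definition coboundary k l : {pred cocycles k l} :=
  fun z => `[< is_coboundary (cocycle_val z) >].

Lemma coboundary_zmod_closed k l : zmod_closed (@coboundary k l).
Proof.
case: k => [|k]; (split=> [|y z /asboolP + /asboolP]; [apply/asboolP|]) => //=.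
- by move=> y0 z0; apply/asboolP; rewrite /= y0 z0 subr0.
- by exists 0; rewrite raddf0.
- move=> [f yf] [g zg]; apply/asboolP; exists (f - g).
  by rewrite raddfB /= -yf -zg.
Qed.
HB.instance Definition _ k l :=
  GRing.isZmodClosed.Build (cocycles k l) (@coboundary k l)
    (@coboundary_zmod_closed k l).

Definition MH k l := Quotient.quot (@coboundary k l).
HB.instance Definition _ k l := GRing.Zmodule.on (MH k l).
HB.instance Definition _ k l := EqQuotient.on (MH k l).

Lemma is_coboundary_ev k k' l (f : cochain k l) (g : cochain k' l) :
  k = k'.+1 ->
  (forall x, is_simplex k l x -> ev f x = ev (cobound g) x) -> is_coboundary f.
Proof. by move=> e; subst k => fg; exists g; apply: ev_ext. Qed.

Lemma eq_MH k l (y z : cocycles k l) :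
  is_coboundary (cocycle_val y - cocycle_val z) ->
  \pi_(MH k l) y = \pi_(MH k l) z.
Proof. by move=> yz; apply/eqP; rewrite piE /Quotient.equiv; apply/asboolP. Qed.

Lemma MH_eq k l (y z : cocycles k l) :
  \pi_(MH k l) y = \pi_(MH k l) z ->
  is_coboundary (cocycle_val y - cocycle_val z).
Proof. by move/eqP; rewrite piE /Quotient.equiv => /asboolP. Qed.

Lemma cochain_mul_cocycle k1 l1 k2 l2 (y : cocycles k1 l1)
    (z : cocycles k2 l2) : cochain_mul y z \in @cocycle (k1 + k2) (l1 +l l2).
Proof.
apply/eqP/ev_ext => x hx; rewrite leibniz // !cobound_cocycle !ev0.
by rewrite mul0r !mulr0 addr0.
Qed.

Definition cocycle_mul k1 l1 k2 l2 (y : cocycles k1 l1) (z : cocycles k2 l2) :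
  cocycles (k1 + k2) (l1 +l l2) := Cocycle (cochain_mul_cocycle y z).

Lemma cochain_one_cocycle : cochain_one \in @cocycle 0 0%:nng.
Proof. by apply/eqP/ev_ext => x hx; rewrite ev_cobound // big_ord0 ev0. Qed.

(* Well defined on classes by pi_MH_mul below. *)
Definition MH_mul k1 l1 k2 l2 (a : MH k1 l1) (b : MH k2 l2) :
  MH (k1 + k2) (l1 +l l2) :=
  \pi_(MH (k1 + k2) (l1 +l l2)) (cocycle_mul (repr a) (repr b)).

Definition MH_one : MH 0 0%:nng := \pi_(MH 0 0%:nng) (Cocycle cochain_one_cocycle).

Lemma cochain_mul_cobound_l k1 l1 k2 l2 (f : cochain k1 l1)
    (z : cocycles k2 l2) :
  is_coboundary f -> is_coboundary (cochain_mul f z).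
Proof.
case: k1 f => [f /= ->|k1 f /= [g ->]].
  rewrite (_ : cochain_mul _ _ = 0); first exact: is_coboundary0.
  by apply: ev_ext => x hx; rewrite ev_mul !ev0 mul0r.
exists (cochain_mul g z); apply: ev_ext => x hx.
rewrite [RHS]leibniz // cobound_cocycle ev0 !mulr0 addr0.
exact: (ev_mul (cobound g) z).
Qed.

Lemma cochain_mul_cobound_r k1 l1 k2 l2 (y : cocycles k1 l1)
    (f : cochain k2 l2) :
  is_coboundary f -> is_coboundary (cochain_mul y f).
Proof.
case: k2 f => [f /= ->|k2 f /= [g ->]].
  rewrite (_ : cochain_mul _ _ = 0); first exact: is_coboundary0.
  by apply: ev_ext => x hx; rewrite ev_mul !ev0 mulr0.
apply: (@is_coboundary_ev _ _ _ _
  (if odd k1 then - cochain_mul y g else cochain_mul y g) (addnS k1 k2)).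
move=> x hx; rewrite ev_mul; rewrite addnS in hx.
transitivity ((-1) ^+ k1 * ev (cobound (cochain_mul y g)) x); last first.
  rewrite -signr_odd; case: (odd k1); last by rewrite mul1r.
  by rewrite raddfN -[- cobound _]sub0r evB ev0 sub0r mulN1r.
rewrite leibniz // cobound_cocycle ev0 mul0r add0r mulrA -exprD addnn.
by rewrite -signr_odd odd_double mul1r.
Qed.

Lemma pi_MH_mul k1 l1 k2 l2 (y : cocycles k1 l1) (z : cocycles k2 l2) :
  MH_mul (\pi_(MH k1 l1) y) (\pi_(MH k2 l2) z) =
    \pi_(MH (k1 + k2) (l1 +l l2)) (cocycle_mul y z).
Proof.
rewrite /MH_mul; set y' := repr _; set z' := repr _.
have yy' : \pi_(MH k1 l1) y' = \pi_(MH k1 l1) y by rewrite reprK.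
have zz' : \pi_(MH k2 l2) z' = \pi_(MH k2 l2) z by rewrite reprK.
transitivity (\pi_(MH (k1 + k2) (l1 +l l2)) (cocycle_mul y z')).
  apply: eq_MH => /=; have /cochain_mul_cobound_l-/(_ _ _ z') := MH_eq yy'.
  congr is_coboundary; apply: ev_ext => x hx.
  by rewrite evB !ev_mul evB mulrBl.
apply: eq_MH => /=; have /cochain_mul_cobound_r-/(_ _ _ y) := MH_eq zz'.
congr is_coboundary; apply: ev_ext => x hx.
by rewrite evB !ev_mul evB mulrBr.
Qed.

End Magnitude.

(* The bigraded ring MH is given by its homogeneous components MH X k l, so an
   isomorphism is a family of bijective additive maps, one for each bidegree,
   that is compatible with the products and the unit. *)
Definition bigraded_ring_iso (R : realType) (X Y : eqmetric R)
    (F : forall k l, {additive MH X k l -> MH Y k l}) : Prop :=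
  [/\ forall k l, bijective (F k l),
      forall k1 l1 k2 l2 (a : MH X k1 l1) (b : MH X k2 l2),
        F _ _ (MH_mul a b) = MH_mul (F _ _ a) (F _ _ b)
    & F _ _ (MH_one X) = MH_one Y].

Record digraph := Digraph {
  vertex :> Type;
  edge : vertex -> vertex -> Prop;
  edge_irr : forall x, ~ edge x x
}.

Definition digraph_iso (G H : digraph) (f : G -> H) : Prop :=
  bijective f /\ forall x y, edge x y <-> edge (f x) (f y).

Section ShortestPath.
Variables (R : realType) (G : digraph).

(* Vertices may repeat along p; this does not change the minimal n. *)
Definition has_path n (x y : G) :=
  exists p : nat -> G,
    [/\ p 0 = x, p n = y & forall i, (i < n)%N -> edge (p i) (p i.+1)].

Definition path_dist (x y : G) : \bar R :=
  match pselect (exists n, `[< has_path n x y >]) with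
  | left h => ((ex_minn h)%:R)%:E
  | right _ => +oo%E
  end.

Variant path_dist_spec x y : \bar R -> Prop :=
  | PathDistFin n of has_path n x y & (forall m, has_path m x y -> (n <= m)%N) :
      path_dist_spec x y (n%:R)%:E
  | PathDistInf of (forall m, ~ has_path m x y) : path_dist_spec x y +oo%E.

Lemma path_distP x y : path_dist_spec x y (path_dist x y).
Proof.
rewrite /path_dist; case: pselect => [h|h].
  case: ex_minnP => n /asboolP hn nmin; apply: PathDistFin => // m hm.
  by apply: nmin; apply/asboolP.
by apply: PathDistInf => m hm; apply: h; exists m; apply/asboolP.
Qed.

Lemma path_dist_ge0 x y : (0 <= path_dist x y)%E.
Proof. by case: path_distP => [n _ _|_] //; rewrite lee_fin. Qed.

Lemma has_path0 x : has_path 0 x x.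
Proof. by exists (fun=> x). Qed.

Lemma path_dist_eq0 x y : path_dist x y = 0%E <-> x = y.
Proof.
split=> [|->].
  case: path_distP => // n [p [px py _]] _ [] /eqP.
  by rewrite pnatr_eq0 => /eqP n0; rewrite -px -py n0.
case: path_distP => [n _ /(_ _ (has_path0 y))|/(_ _ (has_path0 y))//].
by rewrite leqn0 => /eqP ->.
Qed.

Lemma has_path_cat m n x y z :
  has_path m x y -> has_path n y z -> has_path (m + n) x z.
Proof.
move=> [p [p0 pm pe]] [q [q0 qn qe]].
exists (fun i => if (i <= m)%N then p i else q (i - m)%N); split=> //.
  case: ifP => [nm|_]; last by rewrite addKn.
  have n0 : n = 0%N by lia.
  by rewrite -qn n0 addn0 pm q0.
move=> i imn; case: (ltngtP i m) => [im|mi|im]; first exact: pe.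
  by rewrite subSn ?(ltnW mi) //; apply: qe; lia.
by rewrite im subSnn pm -q0; apply: qe; lia.
Qed.

Lemma path_dist_triangle x y z :
  (path_dist x z <= path_dist x y + path_dist y z)%E.
Proof.
case: (path_distP x y) => [m hm _|_]; last first.
  by case: (path_distP y z) => *; rewrite leey.
case: (path_distP y z) => [n hn _|_]; last by rewrite leey.
have hmn := has_path_cat hm hn; case: path_distP => [p _|]; last by move/(_ _ hmn).
by move/(_ _ hmn); rewrite -EFinD lee_fin -natrD ler_nat.
Qed.

Definition digraph_metric : eqmetric R :=
  EQMetric path_dist_ge0 path_dist_eq0 path_dist_triangle.

End ShortestPath.

(* Main.v *)
Require Import Defs.
From mathcomp Require Import all_boot all_algebra reals.
From mathcomp Require Import order freeg boolp.
From mathcomp Require Import constructive_ereal interval_inference.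
Set Implicit Arguments.
Unset Strict Implicit.

(** A directed graph can be read off the part of its magnitude cohomology ring
in bidegrees (0, 0) and (1, 1).

No cochain of degree at most 1 is a coboundary unless it vanishes, because the
coboundary of a 0-cochain is an empty sum.  So in these degrees a class is just
a cocycle, and its values on simplices determine it ([MH_val_inj]).

In bidegree (0, 0) there are no conditions at all: MH is the ring of all
integer-valued functions on the set of points.  Its idempotents are the
indicators of subsets, and the primitive ones are the indicators of single
points ([primitiveP]).  A ring isomorphism permutes primitive idempotents, which
gives a bijection between the sets of points of any two spaces with isomorphic
rings ([MH_iso_points]).  This works for infinitely many points too: a nonzero
idempotent is 1 at some point, and minimality compares it with the indicator of
that point alone.

For a directed graph, the 1-simplices of length 1 are the edges, and every
1-cochain of length 1 is a cocycle, since a 2-simplex has length at least 2.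
Multiplying such a cochain by the indicator of x on the left and that of y on
the right keeps only its value on the edge from x to y.  Hence there is an edge
from x to y exactly when the corner e_x MH^1_1 e_y is nonzero ([edge_corner]), a
condition that every bigraded ring isomorphism preserves. *)

Import GRing.Theory Num.Theory Order.TTheory.
Local Open Scope ring_scope.
Local Open Scope quotient_scope.

(** * Classes of degree at most one are functions on simplices *)

Section LowDegree.
Variables (R : realType) (X : eqmetric R).

Definition cochain_of k l (f : simplex X k l -> int) : cochain X k l :=
  (fgext f : {additive MC X k l -> int}).

Lemma ev_cochain_of k l (f : simplex X k l -> int) x (hx : is_simplex k l x) :
  ev (cochain_of f) x = f (mk_simplex hx).
Proof. by rewrite (evE _ hx) /= fgextU. Qed.

(** A coboundary in degree 0 is zero by convention; in degree 1 it is a sum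
over the interior vertices of a 1-simplex, of which there are none. *)
Lemma coboundary_low k l (f : cochain X k l) :
  (k <= 1)%N -> is_coboundary f -> f = 0.
Proof.
case: k f => [|[|k]] //= f _ [g ->]; apply: ev_ext => x hx.
by rewrite ev_cobound // big_ord0 ev0.
Qed.

(** In degree at most 1 this does not depend on the representative; see
[MH_val_pi]. *)
Definition MH_val k l (a : MH X k l) (x : nat -> X) : int := ev (repr a) x.

Lemma MH_val_pi k l (z : cocycles X k l) x :
  (k <= 1)%N -> MH_val (\pi_(MH X k l) z) x = ev z x.
Proof.
move=> k1; apply/eqP; rewrite -subr_eq0 -evB.
by rewrite (coboundary_low k1 (MH_eq (reprK _))) ev0.
Qed.

Lemma MH_val_inj k l (a b : MH X k l) :
  (forall x, is_simplex k l x -> MH_val a x = MH_val b x) -> a = b.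
Proof.
move=> ab; rewrite -[a]reprK -[b]reprK; congr (\pi _).
by apply: val_inj; apply: ev_ext.
Qed.

Lemma MH_val0 k l x : (k <= 1)%N -> MH_val (0 : MH X k l) x = 0.
Proof.
move=> k1; have -> : 0 = \pi_(MH X k l) 0 by rewrite raddf0.
by rewrite MH_val_pi // ev0.
Qed.

Lemma MH_val_mul k1 l1 k2 l2 (a : MH X k1 l1) (b : MH X k2 l2) x :
  (k1 + k2 <= 1)%N ->
  MH_val (MH_mul a b) x = MH_val a x * MH_val b (fun n => x (k1 + n)%N).
Proof. by move=> k12; rewrite /MH_mul MH_val_pi // ev_mul. Qed.

Lemma MH_neq0 k l (a : MH X k l) x :
  (k <= 1)%N -> MH_val a x <> 0 -> a <> 0.
Proof. by move=> k1 ax a0; apply: ax; rewrite a0 MH_val0. Qed.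

Lemma MH_neq0_val k l (a : MH X k l) :
  (k <= 1)%N -> a <> 0 -> exists2 x, is_simplex k l x & MH_val a x <> 0.
Proof.
move=> k1 a0; apply: contrapT => h; apply: a0; apply: MH_val_inj => x hx.
by rewrite MH_val0 //; apply: contrapT => ax; apply: h; exists x.
Qed.

End LowDegree.

(** * Bidegree (0, 0) and its primitive idempotents *)

Section Points.
Variables (R : realType) (X : eqmetric R).
Implicit Types a b e : MH X 0 0%:nng.

Lemma is_simplex0 (x : nat -> X) : is_simplex 0 0%:nng x.
Proof. by split=> //; rewrite /len big_ord0. Qed.

Definition point_cochain (p : X) : cochain X 0 0%:nng :=
  cochain_of (fun s => `[< vtx s ord0 = p >]%:R).

Lemma ev_point p x : ev (point_cochain p) x = `[< x 0%N = p >]%:R.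
Proof. by rewrite (ev_cochain_of _ (is_simplex0 x)). Qed.

Lemma point_cocycle p : point_cochain p \in @cocycle R X 0 0%:nng.
Proof. by apply/eqP/ev_ext => x hx; rewrite ev_cobound // big_ord0 ev0. Qed.

Definition point_class p : MH X 0 0%:nng :=
  \pi_(MH X 0 0%:nng) (Cocycle (point_cocycle p)).

Lemma MH_val_point p x : MH_val (point_class p) x = `[< x 0%N = p >]%:R.
Proof. by rewrite MH_val_pi // ev_point. Qed.

Lemma MH_val_one x : MH_val (MH_one X) x = 1.
Proof. by rewrite MH_val_pi // (evE _ (is_simplex0 x)) /= fgextU. Qed.

Lemma MH_val_const a x : MH_val a x = MH_val a (fun=> x 0%N).
Proof. by apply: eq_ev => n; rewrite leqn0 => /eqP ->. Qed.

Lemma point_class_inj : injective point_class.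
Proof.
move=> p q pq; have := MH_val_point p (fun=> p).
by rewrite pq MH_val_point [in RHS]asboolT //; case: asboolP.
Qed.

(** The products a * b and a * 1 live in the length 0 + 0, which equals 0 only
up to a proof; comparing with a * 1 instead of a keeps both sides in one
group. *)
Definition idempotent_class a := MH_mul a a = MH_mul a (MH_one X).

Definition primitive_class e :=
  [/\ e <> 0, idempotent_class e &
      forall a, idempotent_class a ->
        MH_mul e a = 0 \/ MH_mul e a = MH_mul e (MH_one X)].

Lemma idempotent_val a x :
  idempotent_class a -> MH_val a x = 0 \/ MH_val a x = 1.
Proof.
move=> /(congr1 (fun c => MH_val c x)); rewrite !MH_val_mul //= MH_val_one.
case: (eqVneq (MH_val a x) 0) => [|a0 /(mulfI a0)]; by [left | right].
Qed.

Lemma point_idempotent p : idempotent_class (point_class p).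
Proof.
apply: MH_val_inj => x _; rewrite !MH_val_mul //= MH_val_one !MH_val_point.
by case: asboolP.
Qed.

Lemma point_primitive p : primitive_class (point_class p).
Proof.
split; [|exact: point_idempotent|move=> a ia].
  by apply: (@MH_neq0 _ _ _ _ _ (fun=> p)) => //; rewrite MH_val_point asboolT.
case: (idempotent_val (fun=> p) ia) => ap; [left|right];
  apply: MH_val_inj => x _; rewrite !MH_val_mul //= ?MH_val_one ?MH_val0 //;
  rewrite MH_val_point; case: asboolP => [xp|_]; rewrite ?mul0r //;
  by rewrite MH_val_const xp ap.
Qed.

(** A primitive idempotent that does not vanish at p is not killed by the
indicator of p, hence is fixed by it, hence is that indicator. *)
Lemma primitiveP e : primitive_class e <-> exists p, e = point_class p.
Proof.
split=> [[e0 ie min_e]|[p ->]]; last exact: point_primitive.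
have [x _ ex] := MH_neq0_val (isT : (0 <= 1)%N) e0; exists (x 0%N).
have ex1 : MH_val e x = 1 by case: (idempotent_val x ie).
case: (min_e _ (point_idempotent (x 0%N))) => ep.
  case: ex; move/(congr1 (fun c => MH_val c x)): ep.
  by rewrite MH_val0 // MH_val_mul //= MH_val_point asboolT // mulr1.
apply: MH_val_inj => y _; move/(congr1 (fun c => MH_val c y)): ep.
rewrite !MH_val_mul //= MH_val_one mulr1 => <-; rewrite MH_val_point.
case: asboolP => [yx|_]; last by rewrite mulr0.
by rewrite MH_val_const yx -(MH_val_const e x) ex1.
Qed.

End Points.

(** * The bijection on points induced by an isomorphism *)

Section Isomorphism.
Variables (R : realType) (X Y : eqmetric R).
Variable F : forall k l, {additive MH X k l -> MH Y k l}.
Hypothesis isoF : bigraded_ring_iso F.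

Lemma MH_iso_inj k l : injective (F k l).
Proof. by case: isoF => bF _ _; exact: bij_inj. Qed.

Lemma MH_iso_eq0 k l (a : MH X k l) : F k l a = 0 <-> a = 0.
Proof.
split=> [|->]; last exact: raddf0.
by rewrite -(raddf0 (F k l)) => /MH_iso_inj.
Qed.

Lemma MH_iso_idempotent a :
  idempotent_class (F 0 0%:nng a) <-> idempotent_class a.
Proof.
case: isoF => _ FM F1; rewrite /idempotent_class -F1 -!FM.
by split=> [/MH_iso_inj|->].
Qed.

(** Being primitive is expressed by products, the unit and zero alone, all of
which F preserves and, being injective, reflects; surjectivity is what lets
minimality against classes of X become minimality against classes of Y. *)
Lemma MH_iso_primitive e : primitive_class (F 0 0%:nng e) <-> primitive_class e.
Proof.
have [bF FM F1] := isoF; split=> -[e0 /MH_iso_idempotent ie min_e];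
  (split; [by move=> /MH_iso_eq0 | exact: ie | ]) => a.
  move=> /MH_iso_idempotent/min_e; rewrite -F1 -!FM.
  by case=> [/MH_iso_eq0|/MH_iso_inj]; [left|right].
have [G _ GK] := bF 0%N 0%:nng.
rewrite -(GK a) => /MH_iso_idempotent/min_e; rewrite -F1 -!FM.
by case=> ->; [left; exact: raddf0|right].
Qed.

Lemma MH_iso_points : exists2 f : X -> Y, bijective f &
  forall p, F 0 0%:nng (point_class p) = point_class (f p).
Proof.
have [bF _ _] := isoF; have [F' _ FK] := bF 0%N 0%:nng.
have /choice[f fE] p : exists q, F 0 0%:nng (point_class p) = point_class q.
  exact/primitiveP/MH_iso_primitive/point_primitive.
have /choice[g gE] q : exists p, F 0 0%:nng (point_class p) = point_class q.
  have /primitiveP[p Ep] : primitive_class (F' (point_class q)).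
    by apply/MH_iso_primitive; rewrite FK; exact: point_primitive.
  by exists p; rewrite -Ep FK.
exists f => //; exists g => [p|q]; apply: point_class_inj.
  by apply: (@MH_iso_inj 0%N 0%:nng); rewrite gE fE.
by rewrite -fE gE.
Qed.

End Isomorphism.

(** * Edges as nonzero corners in bidegree (1, 1) *)

Section Corners.
Variables (R : realType) (X : eqmetric R).

(** The left factor restricts the source of a 1-simplex and the right factor its
target, so that corners see the direction of a 1-simplex. *)
Definition corner l (p q : X) (c : MH X 1 l) :=
  MH_mul (MH_mul (point_class p) c) (point_class q).

Lemma MH_val_corner l p q (c : MH X 1 l) x :
  MH_val (corner p q c) x =
    `[< x 0%N = p >]%:R * MH_val c x * `[< x 1%N = q >]%:R.
Proof. by rewrite !MH_val_mul // !MH_val_point. Qed.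

End Corners.

Section Edges.
Variables (R : realType) (G : digraph).
Local Notation X := (digraph_metric R G).

Lemma path_dist_ge1 (x y : G) : x <> y -> (1 <= path_dist R x y)%E.
Proof.
case: path_distP => [n [p [px py _]] _ xy|_ _]; last exact: leey.
rewrite lee_fin ler1n lt0n; apply/eqP => n0.
by apply: xy; rewrite -px -py n0.
Qed.

Lemma path_dist1 (x y : G) : path_dist R x y = 1%E <-> edge x y.
Proof.
split=> [|exy].
  case: path_distP => // n [p [px py pe]] _ [] /eqP.
  rewrite -[1]/(1%:R) eqr_nat => /eqP n1; subst n; rewrite -px -py.
  exact: pe.
apply/le_anti/andP; split; last first.
  by apply: path_dist_ge1 => xy; case: (@edge_irr G x); rewrite {2}xy.
have hp : has_path 1 x y.
  by exists (fun n => if n is 0 then x else y); split=> // -[].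
case: path_distP => [n _ /(_ _ hp)|/(_ _ hp)//].
by rewrite lee_fin -[1]/(1%:R) ler_nat.
Qed.

Lemma simplex11P (x : nat -> X) :
  is_simplex 1 1%:nng x <-> edge (x 0%N : G) (x 1%N).
Proof.
rewrite /is_simplex /len big_ord1 /=; split=> [[_ /path_dist1]//|e].
split; last exact/path_dist1.
by case=> // _ x01; case: (@edge_irr G (x 0%N)); rewrite {2}x01.
Qed.

Lemma no_simplex21 (x : nat -> X) : ~ is_simplex 2 1%:nng x.
Proof.
move=> [nx]; rewrite /len big_ord_recl big_ord1 /= => l1.
have := leeD (path_dist_ge1 (nx 0%N isT)) (path_dist_ge1 (nx 1%N isT)).
by rewrite l1 -EFinD lee_fin -[1]/(1%:R) -natrD ler_nat.
Qed.

Definition edge_cochain : cochain X 1 1%:nng := cochain_of (fun=> 1).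

Lemma edge_cocycle : edge_cochain \in @cocycle R X 1 1%:nng.
Proof. by apply/eqP/ev_ext => x /no_simplex21. Qed.

(** The cochain equal to 1 on every edge is a cocycle, and its corner at (p, q)
is nonzero as soon as there is an edge there to evaluate it on. *)
Lemma edge_corner (p q : G) :
  edge p q <-> exists c : MH X 1 1%:nng, corner (p : X) q c <> 0.
Proof.
split=> [epq|[c /(MH_neq0_val (isT : (1 <= 1)%N))[x _]]].
  exists (\pi_(MH X 1 1%:nng) (Cocycle edge_cocycle)).
  pose x n : X := if n is 0 then p else q.
  apply: (@MH_neq0 _ _ _ _ _ x) => //.
  have hx : is_simplex 1 1%:nng x by apply/simplex11P.
  by rewrite MH_val_corner !asboolT // MH_val_pi //= (ev_cochain_of _ hx).
rewrite MH_val_corner; case: asboolP => [xp|]; last by rewrite !mul0r.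
case: asboolP => [xq|]; last by rewrite mulr0.
have [/simplex11P|hx] := pselect (is_simplex 1 1%:nng x).
  by rewrite xp xq.
by rewrite /MH_val ev_out // mulr0 mul0r.
Qed.

End Edges.

Theorem corollary3p3 (R : realType) (G H : digraph) :
  (exists F : forall k l, {additive MH (digraph_metric R G) k l ->
                                    MH (digraph_metric R H) k l},
     bigraded_ring_iso F) ->
  exists f : G -> H, digraph_iso f.
Proof.
case=> F isoF; have [f bf fE] := MH_iso_points isoF; have [bF FM _] := isoF.
exists f; split=> // p q; have [F' _ FK] := bF 1%N 1%:nng.
have cornerF c :
    F _ _ (corner (p : digraph_metric R G) q c) = corner (f p) (f q) (F _ _ c).
  by rewrite /corner !FM !fE.
split=> /edge_corner -/(_ R)[c c0]; apply/(edge_corner R).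
  by exists (F _ _ c); rewrite -cornerF => /(MH_iso_eq0 isoF).
by exists (F' c) => c'0; apply: c0; rewrite -(FK c) -cornerF c'0 raddf0.
Qed.
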